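(* Let $G=(V,E)$ be an unweighted undirected graph with $n=|V|$. The subgraph $H$ produced by the construction described in the context contains at most $O(n^{7/5}\log^{3/5}n)$ edges.
   Context: A set $S$ dominates a set $X$ of vertices if every vertex of $X$ is in $S$ or adjacent to a vertex of $S$; dominating sets are computed by the greedy algorithm (repeatedly select the vertex covering the largest number of currently undominated target vertices until all targets are dominated). The construction: initialize $G'=(V',E')=(V,E)$ and $H=(V,\emptyset)$. Step 1: while the vertex $v\in V'$ of largest degree satisfies $\deg_{G'}(v)\ge n^{3/5}/\log^{3/5}n$, add a BFS tree of $G'$ rooted at $v$ to $H$ and remove $v$ and all its neighbors from $G'$. Afterwards a vertex $v\in V'$ is heavy if $\deg_{G'}(v)\ge n^{2/5}\log^{3/5}n$ and light otherwise. Step 2: for each light $u\in V'$, add all edges of $G'$ incident to $u$ to $H$. Step 3: compute (greedily) $S_1\subseteq V'$ dominating all heavy vertices in $G'$, and for each heavy vertex add to $H$ an edge connecting it to some vertex of $S_1$. Step 4: for each $v\in S_1$, compute a BFS tree $T_v$ of $G'$ rooted at $v$ such that for every $u\in V'$ the tree path from $v$ to $u$ minimizes the total vertex degree (in $G'$) along the path; let $p_{v,u}$ be the parent of $u$ in $T_v$, set $f_{v,v}=\deg_{G'}(v)$ and $f_{v,u}=f_{v,p_{v,u}}+\deg_{G'}(u)$, and let $s_{v,u}$ be the sum of $G'$-degrees of vertices in the subtree of $T_v$ rooted at $u$. Step 5: build a bipartite graph $B=(L,R,C)$ with $L=V'$: for each $v\in S_1$ and $u\in V'$ with $f_{v,u}>n^{3/5}\log^{2/5}n$,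 $f_{v,p_{v,u}}\le n^{3/5}\log^{2/5}n$ and $s_{v,u}>3n^{3/5}\log^{2/5}n$, put a node $(v,u)$ in $R$ and join it in $C$ to every $x\in V'$ adjacent (in $G'$) to some vertex on the $v$--$u$ path in $T_v$. Step 6: compute (greedily) $S_2\subseteq L$ dominating all vertices of $R$ in $B$, and for each $x\in S_2$ add a BFS tree of $G'$ rooted at $x$ to $H$. Step 7: for each $v,u\in S_1$ with $f_{v,u}\le 5n^{3/5}\log^{2/5}n$, add the $v$--$u$ path in $T_v$ to $H$. *)

(* Defs.v *)
From mathcomp Require Import all_boot all_order all_algebra.
From mathcomp Require Import reals exp.

Set Implicit Arguments.
Unset Strict Implicit.
Unset Printing Implicit Defensive.

Import Order.TTheory GRing.Theory Num.Theory.
Local Open Scope ring_scope.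

(* Graphs on a finite type T are relations [g : rel T]; the graph G' of the
   construction is the subgraph of G induced by the surviving vertices W. Edge
   sets are sets of unordered pairs, so that #|H| is the number of edges. *)

Definition induced (T : finType) (e : rel T) (W : {set T}) : rel T :=
  [rel x y | [&& x \in W, y \in W & e x y]].

Definition deg (T : finType) (g : rel T) (v : T) : nat := #|[set w | g v w]|.

(* [s] lists all the vertices of the walk, both endpoints included. *)
Definition walk (T : finType) (g : rel T) (v u : T) (s : seq T) : bool :=
  if s is x :: s' then [&& x == v, path g v s' & last v s' == u] else false.

Definition shortest_path (T : finType) (g : rel T) (v u : T) (s : seq T) : Prop :=
  walk g v u s /\ forall s', walk g v u s' -> (size s <= size s')%N.

Definition degree_sum (T : finType) (g : rel T) (s : seq T) : nat :=
  (\sum_(x <- s) deg g x)%N.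

(* A rooted tree is given by its parent map; [p u = None] when [u] is the root
   or is not in the tree. *)
Definition parent_map (T : finType) := {ffun T -> option T}.

(* The path from the root down to [u]: u, p u, p (p u), ... reversed. A path in
   a tree has at most #|T| vertices, whence the number of iterations. *)
Definition tree_path (T : finType) (p : parent_map T) (u : T) : seq T :=
  rev (pmap id (traject (obind p) (Some u) #|T|)).

Definition tree_edges (T : finType) (p : parent_map T) : {set {set T}} :=
  [set [set u; w] | u in T, w in T & p u == Some w].

Definition path_edges (T : finType) (p : parent_map T) (u : T) : {set {set T}} :=
  [set [set y; w] | y in T, w in T & (y \in tree_path p u) && (p y == Some w)].

(* As [g] need not be connected, the tree spans the component of its root. *)
Definition bfs_tree (T : finType) (g : rel T) (v : T) (p : parent_map T) : Prop :=
  [/\ p v = None,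
      forall u, connect g v u -> shortest_path g v u (tree_path p u)
    & forall u, ~~ connect g v u -> p u = None].

(* The competitors are the shortest paths, as the tree has to be a BFS tree. *)
Definition min_degree_bfs_tree (T : finType) (g : rel T) (v : T)
    (p : parent_map T) : Prop :=
  bfs_tree g v p /\
  forall u s, connect g v u -> shortest_path g v u s ->
    (degree_sum g (tree_path p u) <= degree_sum g s)%N.

Definition subtree (T : finType) (p : parent_map T) (u : T) : {set T} :=
  [set x | u \in tree_path p x].

Definition dominated (T : finType) (g : rel T) (S : {set T}) (x : T) : bool :=
  (x \in S) || [exists a in S, g a x].

Definition dominates (T : finType) (g : rel T) (S X : {set T}) : bool :=
  [forall x in X, dominated g S x].

Definition new_cover (T : finType) (g : rel T) (X S : {set T}) (a : T) : nat :=
  #|[set x in X | ~~ dominated g S x & dominated g [set a] x]|.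

(* [greedy g K X S S']: starting from the selection [S], the greedy algorithm
   with candidates [K] and targets [X] may stop with the selection [S']. Ties
   are broken arbitrarily. *)
Inductive greedy (T : finType) (g : rel T) (K X : {set T}) :
    {set T} -> {set T} -> Prop :=
| greedy_stop (S : {set T}) : dominates g S X -> greedy g K X S S
| greedy_pick (S : {set T}) (a : T) (S' : {set T}) :
    ~~ dominates g S X ->
    a \in K ->
    (forall b, b \in K -> (new_cover g X S b <= new_cover g X S a)%N) ->
    greedy g K X (a |: S) S' ->
    greedy g K X S S'.

Definition bfs_threshold (R : realType) (n : nat) : R :=
  n%:R `^ (3 / 5) / ln n%:R `^ (3 / 5).

Definition heavy_threshold (R : realType) (n : nat) : R :=
  n%:R `^ (2 / 5) * ln n%:R `^ (3 / 5).

Definition path_threshold (R : realType) (n : nat) : R :=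
  n%:R `^ (3 / 5) * ln n%:R `^ (2 / 5).

(* [step1 R e W H W' H']: the while loop, started with surviving vertices [W]
   and edge set [H], may terminate with [W'] and [H']. *)
Inductive step1 (R : realType) (T : finType) (e : rel T) :
    {set T} -> {set {set T}} -> {set T} -> {set {set T}} -> Prop :=
| step1_stop (W : {set T}) (H : {set {set T}}) :
    (forall v, v \in W -> (deg (induced e W) v)%:R < bfs_threshold R #|T|) ->
    step1 R e W H W H
| step1_iter (W : {set T}) (H : {set {set T}}) (v : T) (p : parent_map T)
    (W' : {set T}) (H' : {set {set T}}) :
    v \in W ->
    (forall w, w \in W -> (deg (induced e W) w <= deg (induced e W) v)%N) ->
    bfs_threshold R #|T| <= (deg (induced e W) v)%:R ->
    bfs_tree (induced e W) v p ->
    step1 R e (W :\: (v |: [set w | induced e W v w])) (H :|: tree_edges p)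
      W' H' ->
    step1 R e W H W' H'.

Definition heavy (R : realType) (T : finType) (g : rel T) (W : {set T}) :
    {set T} :=
  [set v in W | heavy_threshold R #|T| <= (deg g v)%:R].

Definition light (R : realType) (T : finType) (g : rel T) (W : {set T}) :
    {set T} :=
  W :\: heavy R g W.

Definition light_edges (R : realType) (T : finType) (g : rel T) (W : {set T}) :
    {set {set T}} :=
  [set [set u; w] | u in T, w in T & (u \in light R g W) && g u w].

(* [c v = Some w] when the edge {v, w} is added for the heavy vertex [v]. A
   heavy vertex outside S1 gets an edge to a neighbour in S1; one inside S1,
   which dominates itself and may have no neighbour in S1, may get none. *)
Definition heavy_connection (R : realType) (T : finType) (g : rel T)
    (W S1 : {set T}) (c : {ffun T -> option T}) : Prop :=
  forall v, v \in heavy R g W ->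
    (v \notin S1 -> c v != None) /\
    (forall w, c v = Some w -> w \in S1 /\ g v w).

Definition heavy_edges (R : realType) (T : finType) (g : rel T) (W : {set T})
    (c : {ffun T -> option T}) : {set {set T}} :=
  [set [set v; w] | v in T, w in T & (v \in heavy R g W) && (c v == Some w)].

(* The recursion defining f_{v,u}, which is meaningful for [u] in the tree. *)
Definition path_weight (T : finType) (g : rel T) (v : T) (p : parent_map T)
    (f : T -> nat) : Prop :=
  f v = deg g v /\ forall u w, p u = Some w -> f u = (f w + deg g u)%N.

Definition subtree_weight (T : finType) (g : rel T) (p : parent_map T) (u : T) :
    nat :=
  (\sum_(x in subtree p u) deg g x)%N.

Definition right_nodes (R : realType) (T : finType) (g : rel T)
    (W S1 : {set T}) (tr : T -> parent_map T) (f : T -> T -> nat) :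
    {set T * T} :=
  [set vu : T * T | let: (v, u) := vu in
    [&& v \in S1, u \in W &
      if tr v u is Some w then
        [&& path_threshold R #|T| < (f v u)%:R,
            (f v w)%:R <= path_threshold R #|T|
          & 3 * path_threshold R #|T| < (subtree_weight g (tr v) u)%:R]
      else false]].

Definition bip_join (T : finType) (g : rel T) (W : {set T})
    (tr : T -> parent_map T) (RN : {set T * T}) (x : T) (vu : T * T) : bool :=
  [&& x \in W, vu \in RN & [exists y in tree_path (tr vu.1) vu.2, g x y]].

(* The bipartite graph B, on the left nodes [inl x] and right nodes
   [inr (v, u)]. *)
Definition bip (T : finType) (g : rel T) (W : {set T})
    (tr : T -> parent_map T) (RN : {set T * T}) : rel (T + T * T)%type :=
  fun a b => match a, b with
             | inl x, inr vu => bip_join g W tr RN x vu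
             | inr vu, inl x => bip_join g W tr RN x vu
             | _, _ => false
             end.

Definition bip_left (T : finType) (W : {set T}) : {set T + T * T} :=
  [set inl x | x in W].

Definition bip_right (T : finType) (RN : {set T * T}) : {set T + T * T} :=
  [set inr vu | vu in RN].

(* The pairs with [u] in the component of [v] are those for which T_v has a
   v--u path and f_{v,u} is defined. *)
Definition short_path_edges (R : realType) (T : finType) (g : rel T)
    (S1 : {set T}) (tr : T -> parent_map T) (f : T -> T -> nat) :
    {set {set T}} :=
  \bigcup_(v in S1)
    \bigcup_(u in S1 | connect g v u &&
                       ((f v u)%:R <= 5 * path_threshold R #|T|))
      path_edges (tr v) u.

(* [spanner_output R e H]: some run of the construction on the graph (T, e)
   produces the edge set [H]; all choices the algorithm leaves open (ties,
   BFS trees, connecting edges) are arbitrary. *)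
Inductive spanner_output (R : realType) (T : finType) (e : rel T) :
    {set {set T}} -> Prop :=
| SpannerOutput (W : {set T}) (H1 : {set {set T}}) (S1 : {set T})
    (c : {ffun T -> option T}) (tr : T -> parent_map T) (f : T -> T -> nat)
    (S2 : {set T}) (tr2 : T -> parent_map T) :
    let g := induced e W in
    let RN := right_nodes R g W S1 tr f in
    step1 R e [set: T] set0 W H1 ->
    greedy g W (heavy R g W) set0 S1 ->
    heavy_connection R g W S1 c ->
    (forall v, v \in S1 -> min_degree_bfs_tree g v (tr v)) ->
    (forall v, v \in S1 -> path_weight g v (tr v) (f v)) ->
    greedy (bip g W tr RN) (bip_left W) (bip_right RN) set0 [set inl x | x in S2] ->
    (forall x, x \in S2 -> bfs_tree g x (tr2 x)) ->
    spanner_output R e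
      (H1 :|: light_edges R g W :|: heavy_edges R g W c
       :|: \bigcup_(x in S2) tree_edges (tr2 x)
       :|: short_path_edges R g S1 tr f).

(* Main.v *)
(* Every new edge is charged. A round of step 1 adds at most n edges and deletes
   at least n^{3/5} / log^{3/5} n vertices. The greedy algorithm picks at most
   (k / D) log M + 1 candidates when each of M targets is covered by D of the k
   candidates; so S1 has O(n^{3/5} log^{2/5} n) elements. A vertex is adjacent to
   at most three vertices of a shortest path, so a right node (v, u) of B has at
   least f_{v,u} / 3 neighbours, and S2 has O(n^{2/5} log^{3/5} n) elements. In
   step 7, the edge from y to its parent is already present if y is light; the
   heavy vertices of a path have total degree at most 5 n^{3/5} log^{2/5} n, hence
   there are O(n^{1/5} / log^{1/5} n) of them for each of the |S1|^2 pairs. *)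
Require Import Defs.
From mathcomp Require Import all_boot all_order all_algebra.
From mathcomp Require Import reals exp.
From mathcomp Require Import lra ring.
Set Implicit Arguments.
Unset Strict Implicit.
Unset Printing Implicit Defensive.

Import Order.TTheory GRing.Theory Num.Theory.
Local Open Scope ring_scope.

(** * Size of a greedily chosen dominating set *)

Section Greedy.
Variables (R : realType) (U : finType) (g : rel U) (K X : {set U}).

Definition undominated (S : {set U}) : {set U} := [set x in X | ~~ dominated g S x].

Lemma dominates_undominated S : dominates g S X = (undominated S == set0).
Proof.
apply/forall_inP/eqP => [dS|/setP u0 x xX].
  apply/setP => x; rewrite !inE; apply/negP => /andP[xX]; by rewrite dS.
by apply/negPn; have := u0 x; rewrite !inE xX /= => ->.
Qed.

Lemma dominatedU1 S a x :
  dominated g (a |: S) x = dominated g S x || dominated g [set a] x.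
Proof.
apply/idP/idP; rewrite /dominated !inE.
  case/orP => [/orP[->|->]|/exists_inP[b]]; rewrite ?orbT //.
  rewrite !inE; case/orP => [/eqP -> gax|bS gbx].
    by apply/orP; right; apply/orP; right; apply/exists_inP; exists a; rewrite ?inE.
  by apply/orP; left; apply/orP; right; apply/exists_inP; exists b.
case/orP => /orP[->|/exists_inP[b]]; rewrite ?orbT // => bS gbx;
  by move: bS; rewrite ?inE => bS; apply/orP; right; apply/exists_inP; exists b; rewrite ?inE ?bS ?orbT.
Qed.

Lemma card_undominatedU1 S a :
  #|undominated S| = (new_cover g X S a + #|undominated (a |: S)|)%N.
Proof.
rewrite -(cardsID [set x | dominated g [set a] x] (undominated S)).
congr addn; apply: eq_card => x; rewrite (in_setI, in_setD) !in_set.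
  by rewrite andbA.
by rewrite dominatedU1 negb_or andbC andbA.
Qed.

(* Averaging over the candidates. *)
Lemma greedy_choice_cover (D : R) S a :
    (forall x, x \in X -> D <= #|[set b in K | g b x]|%:R) ->
    (forall b, b \in K -> (new_cover g X S b <= new_cover g X S a)%N) ->
  D * #|undominated S|%:R <= #|K|%:R * (new_cover g X S a)%:R.
Proof.
move=> degX amax.
have -> : #|K|%:R * (new_cover g X S a)%:R
    = (\sum_(b in K) new_cover g X S a)%:R :> R by rewrite sum_nat_const natrM.
apply: (@le_trans _ _ (\sum_(b in K) new_cover g X S b)%:R); last first.
  by rewrite ler_nat leq_sum.
have -> : (\sum_(b in K) new_cover g X S b =
    \sum_(x in undominated S) #|[set b in K | dominated g [set b] x]|)%N.
  transitivity (\sum_(b in K) \sum_(x in undominated S | dominated g [set b] x) 1)%N.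
    apply: eq_bigr => b _; rewrite sum1dep_card; apply: eq_card => x.
    by rewrite !inE andbA.
  rewrite (exchange_big_dep (mem (undominated S))) /=; last by move=> ? ? _ /andP[].
  apply: eq_bigr => x xS; rewrite sum1dep_card; apply: eq_card => b.
  by rewrite !inE; move: xS; rewrite inE => ->.
rewrite mulrC mulr_natl -sumr_const natr_sum; apply: ler_sum => x.
rewrite inE => /andP[xX _]; apply: le_trans (degX x xX) _.
rewrite ler_nat; apply/subset_leq_card/subsetP => b; rewrite !inE => /andP[-> gbx] /=.
by rewrite /dominated; apply/orP; right; apply/exists_inP; exists b; rewrite ?inE.
Qed.

(* Each choice multiplies the number of undominated targets by at most
   [1 - D / #|K|]. *)
Lemma card_greedy_from (D : R) S S' :
    0 < D -> (forall x, x \in X -> D <= #|[set b in K | g b x]|%:R) ->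
    greedy g K X S S' ->
  #|S'|%:R <= #|S|%:R + (if #|undominated S| == 0%N then 0 else
     #|K|%:R / D * ln #|undominated S|%:R + 1).
Proof.
move=> D0 degX; elim=> {S S'} [S|S a S'].
  by rewrite dominates_undominated -cards_eq0 => ->; rewrite addr0.
rewrite dominates_undominated -cards_eq0 => /negPf r0 aK amax _ IH.
have := greedy_choice_cover degX amax.
have := card_undominatedU1 S a.
set r := #|undominated S| in r0 *; set r' := #|undominated _| in IH *.
rewrite r0 => rE cov.
have k0 : 0 < #|K|%:R :> R by rewrite ltr0n; apply/card_gt0P; exists a.
have rgt : 1 <= r%:R :> R by rewrite ler1n lt0n r0.
have aS : #|a |: S|%:R <= #|S|%:R + 1 :> R.
  by rewrite natr1 ler_nat cardsU1; case: (_ \notin _).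
have lnr := ln_ge0 rgt.
have kD : 0 < #|K|%:R / D by rewrite divr_gt0.
(* If nothing is left undominated, the summand 1 pays for this last pick. *)
case: eqP IH => [_|/eqP]; first by have := mulr_ge0 (ltW kD) lnr; lra.
rewrite -lt0n -(ltr0n R) => r'0 IH.
(* By [ln (1 + t) <= t] the logarithm drops by at least [D / #|K|]; scaled by [#|K| / D] this is a
   drop of 1, which pays for the pick of [a]. *)
have : ln r'%:R <= ln r%:R - D / #|K|%:R.
  have r'r : r'%:R / r%:R <= 1 - D / #|K|%:R :> R.
    rewrite ler_pdivrMr; last by lra.
    have /= := congr1 (fun m => m%:R : R) rE; rewrite natrD => rE'.
    have : D / #|K|%:R * r%:R <= (new_cover g X S a)%:R.
      by rewrite mulrAC ler_pdivrMr // [leRHS]mulrC.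
    by lra.
  have q0 : 0 < r'%:R / r%:R :> R by rewrite divr_gt0 //; lra.
  rewrite -lerBlDl -ln_div ?posrE //; last by lra.
  have := @le_ln1Dx R (r'%:R / r%:R - 1).
  by rewrite addrCA subrr addr0 => /(_ ltac:(lra)); lra.
move=> /(ler_wpM2l (ltW kD)); rewrite mulrBr.
have -> : #|K|%:R / D * (D / #|K|%:R) = 1 by field; rewrite !gt_eqF.
by lra.
Qed.

Lemma card_greedy (D : R) (M : nat) S :
    0 < D -> (forall x, x \in X -> D <= #|[set b in K | g b x]|%:R) ->
    (0 < M)%N -> (#|X| <= M)%N ->
    greedy g K X set0 S ->
  #|S|%:R <= #|K|%:R / D * ln M%:R + 1.
Proof.
move=> D0 degX M0 XM /(card_greedy_from D0 degX); rewrite cards0 add0r.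
have kD : 0 <= #|K|%:R / D by rewrite divr_ge0 // ltW.
have lnM : 0 <= ln (M%:R : R) by rewrite ln_ge0 // ler1n.
case: eqP => [_|/eqP r0] cS; apply: (le_trans cS).
  by rewrite addr_ge0 // mulr_ge0.
rewrite lerD2r; apply: ler_wpM2l => //; rewrite ler_ln ?posrE ?ltr0n // ?lt0n //.
  rewrite ler_nat.
apply: leq_trans XM; apply/subset_leq_card/subsetP => x.
by rewrite inE => /andP[].
Qed.

End Greedy.

(** * Edges charged to an endpoint, and rooted trees *)

(** Each edge is charged to its endpoint in [Y], from which [c] recovers it. Here [c] will be a
    parent map or the choice of connecting edges in step 3. *)
Lemma card_endpoint_edges (T : finType) (E : {set {set T}}) (Y : {set T})
    (c : T -> option T) :
    (forall z, z \in E -> exists y w, [/\ y \in Y, c y = Some w & z = [set y; w]]) ->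
  (#|E| <= #|Y|)%N.
Proof.
move=> EY; pose F y := if c y is Some w then [set y; w] else set0.
apply: leq_trans (leq_imset_card F Y); apply/subset_leq_card/subsetP => z.
by case/EY => y [w [yY cy ->]]; apply/imsetP; exists y; rewrite // /F cy.
Qed.

Section Trees.
Variables (T : finType) (g : rel T).

Lemma card_tree_edges (p : parent_map T) : (#|tree_edges p| <= #|T|)%N.
Proof.
rewrite -cardsT; apply: (@card_endpoint_edges _ _ _ p) => _ /imset2P[y w _ + ->].
by rewrite inE => /andP[_ /eqP py]; exists y, w.
Qed.

(** With at least two vertices, the iteration defining [tree_path] is long enough to reach the
    parent. *)
Lemma tree_path_parent (p : parent_map T) u w : (1 < #|T|)%N -> p u = Some w ->
  exists s, tree_path p u = rcons (rcons s w) u.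
Proof.
case Tm : #|T| => [|[|m]] // _ puw.
rewrite /tree_path Tm /= puw /=.
by exists (rev (pmap id (traject (obind p) (p w) m))); rewrite !rev_cons.
Qed.

Lemma bfs_tree_connect v p u w :
  bfs_tree g v p -> p u = Some w -> connect g v u.
Proof. by case=> _ _ pN puw; apply/negPn/negP => /pN; rewrite puw. Qed.

Lemma bfs_tree_edge v p u w : (1 < #|T|)%N ->
  bfs_tree g v p -> p u = Some w -> g w u.
Proof.
move=> T1 bt puw; have [_ sp _] := bt.
have [+ _] := sp u (bfs_tree_connect bt puw).
have [s ->] := tree_path_parent T1 puw.
case: s => [|x s] /=; first by case/and3P => /eqP ->; rewrite andbT.
by rewrite !rcons_path last_rcons => /and3P[_ /andP[_ ->]].
Qed.

Lemma path_weight_tree_path v p f u :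
    bfs_tree g v p -> path_weight g v p f -> connect g v u ->
  f u = degree_sum g (tree_path p u).
Proof.
case=> pv sp _ [fv fS] /sp[+ _]; rewrite /tree_path /degree_sum /walk.
move: #|T| => m.
have -> : (\sum_(x <- rev (pmap id (traject (obind p) (Some u) m))) deg g x =
           \sum_(x <- pmap id (traject (obind p) (Some u) m)) deg g x)%N.
  by apply: perm_big; rewrite perm_rev.
set s := pmap _ _ => sw.
(* The induction on the number of iterations keeps only this: the truncated path still starts at the
   root. *)
have {sw} : ohead (rev s) = Some v by case: (rev s) sw => // x s' /and3P[/eqP ->].
rewrite {}/s; elim: m u => [|m IH] u //=; rewrite rev_cons big_cons.
case puw : (p u) => [w|]; last first.
  have -> : pmap id (traject (obind p) None m) = [::] by elim: m {IH}.
  by rewrite /= => -[->]; rewrite big_nil addn0.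
(* With no iteration left the path is [u] alone, so [u] is the root and has no parent. *)
case: m IH => [_ /= [uv]|m IH]; first by rewrite uv pv in puw.
rewrite (fS _ _ puw) addnC => hd; congr addn; apply: IH.
by move: hd => /=; rewrite rev_cons; case: (rev _).
Qed.

End Trees.

(** * Neighbours of a shortest path *)

Section ShortestPaths.
Variables (T : finType) (g : rel T) (symg : symmetric g).

Lemma has_first (P : pred T) s : has P s ->
  exists a s1 s2, [/\ s = s1 ++ a :: s2, P a & ~~ has P s1].
Proof.
by case/split_find => a s1 s2 Pa nP; exists a, s1, s2; rewrite cat_rcons.
Qed.

(* Two neighbours of [x] on a shortest path are at distance at most two along
   the path, for otherwise the detour through [x] is a shortcut. *)
Lemma count_shortest_path v u s x :
  shortest_path g v u s -> (count (g x) s <= 3)%N.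
Proof.
move=> [ws smin]; rewrite leqNgt; apply/negP => c4.
have /has_first[a [s1 [t [st ga nh1]]]] : has (g x) s.
  by rewrite has_count (leq_trans _ c4).
have c3 : (3 <= count (g x) t)%N.
  move: c4; rewrite st count_cat /= ga.
  by move: nh1; rewrite has_count -leqNgt leqn0 => /eqP ->.
have /has_first[b [r3 [r2 [tE gb nh3]]]] : has (g x) (rev t).
  by rewrite has_rev has_count (leq_trans _ c3).
have {}tE : t = rev r2 ++ b :: rev r3.
  by rewrite -[t]revK tE rev_cat rev_cons cat_rcons.
(* [a] and [b] are the first and last neighbours of [x] on the path. At least two vertices lie
   strictly between them, where the detour has only [x]. *)
have c2 : (2 <= size (rev r2))%N.
  apply: leq_trans (count_size (g x) _).
  move: c3; rewrite tE count_cat /= gb [count _ (rev r3)]count_rev.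
  by move: nh3; rewrite has_count -leqNgt leqn0 => /eqP ->; rewrite addn0 addn1.
have /smin : walk g v u (s1 ++ a :: x :: b :: rev r3).
  move: ws; rewrite st tE; case: (s1) => [|y s2] /=.
    case/and3P => /eqP <-; rewrite eqxx cat_path last_cat /= => /and3P[_ _ ->] ->.
    by rewrite gb [g a x]symg ga.
  case/and3P => -> /=; rewrite !cat_path !last_cat /= !cat_path !last_cat /=.
  by rewrite [g a x]symg ga gb => /andP[-> /= /and3P[-> _ /andP[_ ->]]].
rewrite st tE !size_cat /= size_cat /= leq_add2l !ltnS addnS ltnS.
by rewrite -[_.+1]add1n leq_add2r leqNgt c2.
Qed.

(** Double counting of adjacent pairs: a vertex [x] is counted once for each of its neighbours on
    [s], hence at most three times. *)
Lemma degree_sum_shortest_path v u s :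
    shortest_path g v u s ->
  (degree_sum g s <= 3 * #|[set x | [exists y in s, g x y]]|)%N.
Proof.
move=> sp; pose N := [set x | [exists y in s, g x y]].
rewrite mulnC -sum_nat_const.
have -> : (degree_sum g s = \sum_(y <- s) \sum_(x in N | g x y) 1)%N.
  apply: eq_big_seq => y ys; rewrite sum1dep_card; apply: eq_card => x.
  rewrite !inE symg andbC; case gxy: (g x y) => //=.
  by apply/esym/exists_inP; exists y.
rewrite (exchange_big_dep (mem N)) /=; last by move=> ? ? _ /andP[].
apply: leq_sum => x xN.
rewrite (eq_bigl (g x)); last by move=> y; rewrite xN.
by rewrite sum1_count; apply: count_shortest_path sp.
Qed.

End ShortestPaths.

Lemma leq_card_bigcup (I U : finType) (P : pred I) (F : I -> {set U}) :
  (#|\bigcup_(i | P i) F i| <= \sum_(i | P i) #|F i|)%N.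
Proof.
elim/big_rec2: _ => [|i m A _ Am]; first by rewrite cards0.
by apply: leq_trans (leq_card_setU _ _) _; rewrite leq_add2l.
Qed.

Lemma leq_sum_mem (T : finType) (A : {set T}) (s : seq T) (F : T -> nat) :
  {subset A <= s} -> (\sum_(y in A) F y <= \sum_(y <- s) F y)%N.
Proof.
move=> As; apply: (@leq_trans (\sum_(y <- undup s) F y)).
  rewrite big_uniq ?undup_uniq // [leqRHS](bigID [in A]) /=.
  apply: leq_trans (leq_addr _ _); rewrite leq_eqVlt; apply/orP; left.
  apply/eqP/eq_bigl => y; rewrite mem_undup.
  by case yA: (y \in A); rewrite ?andbF // As.
elim: s {As} => //= y s IH; rewrite big_cons.
case: ifP => _; first exact: leq_trans IH (leq_addl _ _).
by rewrite big_cons leq_add2l.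
Qed.

(** * Number of edges added by each step *)

Section EdgeCounts.
Variables (R : realType) (T : finType).
Local Notation n := #|T|.

(** The right-hand side is a potential that no round increases: at most [n] new edges are paid for
    by the deleted vertices. *)
Lemma card_step1 (e : rel T) W H W' H' :
    0 < bfs_threshold R n -> step1 R e W H W' H' ->
  #|H'|%:R <= #|H|%:R + n%:R * (#|W|%:R / bfs_threshold R n).
Proof.
move=> t0; elim=> {W H W' H'} [W H _|W H v p W' H' vW _ tv _ _].
  by rewrite lerDl mulr_ge0 // divr_ge0 // ltW.
set N := _ :\: _ => IH; apply: (le_trans IH).
have HE : #|H :|: tree_edges p|%:R <= #|H|%:R + n%:R :> R.
  rewrite -natrD ler_nat; apply: leq_trans (leq_card_setU _ _) _.
  by rewrite leq_add2l card_tree_edges.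
have WE : #|W|%:R >= #|N|%:R + bfs_threshold R n.
  apply: (@le_trans _ _ (#|N| + deg (induced e W) v)%:R).
    by rewrite natrD lerD2l.
  rewrite ler_nat addnC -(cardsID (v |: [set w | induced e W v w]) W) leq_add2r.
  apply/subset_leq_card/subsetP => w; rewrite !inE /= => evw.
  by rewrite evw orbT andbT; case/and3P: evw.
have : n%:R * ((#|N|%:R + bfs_threshold R n) / bfs_threshold R n) <=
       n%:R * (#|W|%:R / bfs_threshold R n).
  by rewrite ler_wpM2l // ler_wpM2r // invr_ge0 ltW.
by rewrite mulrDl divff ?gt_eqF // mulrDr mulr1; lra.
Qed.

Lemma card_light_edges (g : rel T) W : 0 <= heavy_threshold R n ->
  #|light_edges R g W|%:R <= n%:R * heavy_threshold R n.
Proof.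
move=> t0; have : light_edges R g W \subset
    \bigcup_(u in light R g W) [set [set u; w] | w in [set w | g u w]].
  apply/subsetP => _ /imset2P[u w _ + ->]; rewrite inE => /and3P[_ uL guw].
  by apply/bigcupP; exists u => //; apply/imsetP; exists w; rewrite ?inE.
move/subset_leq_card/leq_trans/(_ (leq_card_bigcup _ _)) => cL.
apply: (@le_trans _ _ (\sum_(u in light R g W) deg g u)%:R).
  rewrite ler_nat; apply: leq_trans cL _; apply: leq_sum => u _.
  exact: leq_imset_card.
rewrite natr_sum; apply: (@le_trans _ _ (\sum_(u in light R g W) heavy_threshold R n)).
  apply: ler_sum => u; rewrite !inE => /andP[+ uW].
  by rewrite uW /= -ltNge => /ltW.
by rewrite sumr_const -[leLHS]mulr_natl ler_wpM2r // ler_nat max_card.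
Qed.

Lemma card_heavy_edges (g : rel T) W c : (#|heavy_edges R g W c| <= n)%N.
Proof.
rewrite -cardsT; apply: (@card_endpoint_edges _ _ _ c) => _ /imset2P[y w _ + ->].
by rewrite inE => /and3P[_ _ /eqP cy]; exists y, w.
Qed.

Lemma card_bigcup_tree_edges (S : {set T}) (tr : T -> parent_map T) :
  (#|\bigcup_(x in S) tree_edges (tr x)| <= #|S| * n)%N.
Proof.
apply: leq_trans (leq_card_bigcup _ _) _; rewrite -sum_nat_const.
by apply: leq_sum => x _; apply: card_tree_edges.
Qed.

(** * Paths of step 7 and sizes of the two dominating sets *)

Section ShortPaths.
Variables (e : rel T) (W S1 : {set T}) (tr : T -> parent_map T).
Variable f : T -> T -> nat.
Local Notation g := (induced e W).
Local Notation h := (heavy_threshold R n).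
Local Notation P := (path_threshold R n).
Hypotheses (syme : symmetric e) (n1 : (1 < n)%N).
Hypothesis trP : forall v, v \in S1 -> min_degree_bfs_tree g v (tr v).
Hypothesis fP : forall v, v \in S1 -> path_weight g v (tr v) (f v).
Hypotheses (h0 : 0 < h) (P0 : 0 < P).

Lemma induced_sym : symmetric g.
Proof. by move=> x y; rewrite /induced /= syme andbCA. Qed.

(** The path edges whose endpoint farther from the root is heavy: the only ones that step 2 may have
    missed. *)
Definition heavy_path_edges (v u : T) : {set {set T}} :=
  [set [set y; w] | y in T, w in T &
    [&& y \in heavy R g W, y \in tree_path (tr v) u & tr v y == Some w]].

(** Each heavy vertex on the path contributes at least [h] to the degree sum [f v u]. *)
Lemma card_heavy_path_edges v u : v \in S1 -> connect g v u ->
  (f v u)%:R <= 5 * P -> #|heavy_path_edges v u|%:R <= 5 * P / h.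
Proof.
move=> vS vu fvu; have [bt _] := trP vS.
pose Y := [set y in heavy R g W | y \in tree_path (tr v) u].
apply: (@le_trans _ _ #|Y|%:R).
  rewrite ler_nat; apply: (@card_endpoint_edges _ _ _ (tr v)).
  move=> _ /imset2P[y w _ + ->]; rewrite inE => /and4P[_ yh ys /eqP yw].
  by exists y, w; rewrite inE yh.
rewrite ler_pdivlMr //; apply: le_trans fvu.
rewrite (path_weight_tree_path bt (fP vS) vu) mulr_natl -sumr_const.
apply: (@le_trans _ _ (\sum_(y in Y) deg g y)%:R).
  by rewrite natr_sum; apply: ler_sum => y; rewrite !inE => /andP[/andP[_ ->]].
by rewrite ler_nat leq_sum_mem // => y; rewrite inE => /andP[].
Qed.

(* Step 2 has added the edge from a light vertex to its parent. *)
Lemma short_path_edges_sub : short_path_edges R g S1 tr f \subset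
  light_edges R g W :|:
  \bigcup_(v in S1) \bigcup_(u in S1 | connect g v u && ((f v u)%:R <= 5 * P))
    heavy_path_edges v u.
Proof.
apply/subsetP => z /bigcupP[v vS /bigcupP[u uS]].
case/imset2P => y w _ + ->; rewrite inE => /and3P[_ ys /eqP yw].
have [bt _] := trP vS.
have gyw : g y w by rewrite induced_sym (bfs_tree_edge n1 bt yw).
rewrite inE; have [yh|yl] := boolP (y \in heavy R g W); apply/orP; [right|left].
  apply/bigcupP; exists v => //; apply/bigcupP; exists u => //.
  by apply/imset2P; exists y w; rewrite // inE yh ys yw /=.
apply/imset2P; exists y w; rewrite // inE [in X in _ && X]/= in_setD yl gyw andbT.
by case/and3P: gyw.
Qed.

(** The union with the light edges is bounded as a whole, so that path edges already present cost
    nothing. *)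
Lemma card_short_path_edges :
  #|light_edges R g W :|: short_path_edges R g S1 tr f|%:R <=
  #|light_edges R g W|%:R + #|S1|%:R * (#|S1|%:R * (5 * P / h)).
Proof.
have := subset_leq_card (setUS (light_edges R g W) short_path_edges_sub).
rewrite setUA setUid => /leq_trans/(_ (leq_card_setU _ _)).
rewrite -(ler_nat R) natrD => /le_trans; apply; rewrite lerD2l.
have sumc (F : T -> {set {set T}}) (Q : pred T) (b : R) : 0 <= b ->
    (forall v, v \in S1 -> Q v -> #|F v|%:R <= b) ->
    #|\bigcup_(v in S1 | Q v) F v|%:R <= #|S1|%:R * b.
  move=> b0 Fb; apply: (@le_trans _ _ (\sum_(v in S1 | Q v) #|F v|)%:R).
    by rewrite ler_nat leq_card_bigcup.
  rewrite mulr_natl -sumr_const natr_sum big_mkcondr /=; apply: ler_sum => v vS.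
  by case: ifP => // Qv; apply: Fb.
have b0 : 0 <= 5 * P / h by apply: divr_ge0; [apply: mulr_ge0 => //|]; apply: ltW.
(* The trivial condition gives the outer union the shape of [sumc], which then serves for both
   unions. *)
rewrite (eq_bigl (fun v => (v \in S1) && true)) => [|v]; last by rewrite andbT.
apply: (sumc) => [|v vS _]; first by rewrite mulr_ge0.
apply: sumc => // u _ /andP[vu fvu]; exact: card_heavy_path_edges.
Qed.

(** Every target is heavy, so its neighbours are at least [h] candidates covering it. *)
Lemma card_S1 : greedy g W (heavy R g W) set0 S1 ->
  #|S1|%:R <= n%:R / h * ln n%:R + 1.
Proof.
have n0 : (0 < n)%N by apply: ltnW.
move=> gr; have := card_greedy h0 _ n0 (max_card _) gr => /(_ _)/le_trans; apply.
  move=> x; rewrite inE => /andP[xW hx]; apply: (le_trans hx).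
  rewrite ler_nat; apply/subset_leq_card/subsetP => y; rewrite !inE => gxy.
  by rewrite induced_sym gxy andbT; case/and3P: gxy.
rewrite lerD2r; apply: ler_wpM2r; first by rewrite ln_ge0 // ler1n.
apply: ler_wpM2r; first by rewrite invr_ge0 ltW.
by rewrite ler_nat max_card.
Qed.

Local Notation RN := (right_nodes R g W S1 tr f).

Lemma card_S2 (S2 : {set T}) :
    greedy (bip g W tr RN) (bip_left W) (bip_right RN) set0 [set inl x | x in S2] ->
  #|S2|%:R <= n%:R / (P / 3) * ln (n * n)%:R + 1.
Proof.
have n0 : (0 < n * n)%N by rewrite muln_gt0 andbb ltnW.
have P3 : 0 < P / 3 by rewrite divr_gt0.
have RNn : (#|bip_right RN| <= n * n)%N.
  by apply: leq_trans (leq_imset_card _ _) _; rewrite -card_prod max_card.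
move=> gr; have := card_greedy P3 _ n0 RNn gr.
rewrite card_imset; last by move=> ? ? [].
move=> /(_ _)/le_trans; apply.
  move=> _ /imsetP[[v u] vuR ->]; have := vuR; rewrite inE.
  case/and3P => vS uW; case uw : (tr v u) => [w|] // /and3P[Pf _ _].
  have [bt _] := trP vS; have vu := bfs_tree_connect bt uw.
  have [_ sp _] := bt.
  (* The neighbours of the tree path are exactly the left nodes joined to [(v, u)]; there are at
     least [f v u / 3] of them, hence at least [P / 3]. *)
  have := degree_sum_shortest_path induced_sym (sp u vu).
  rewrite -(path_weight_tree_path bt (fP vS) vu) -(ler_nat R) natrM => fN.
  rewrite ler_pdivrMr // mulrC; apply: le_trans (ltW Pf) _.
  apply: (le_trans fN); rewrite ler_wpM2l // ler_nat.
  rewrite -(card_imset _ (@inl_inj _ (T * T)%type)).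
  apply/subset_leq_card/subsetP => _ /imsetP[x + ->].
  rewrite inE => /exists_inP[y ys gxy]; have xW : x \in W by case/and3P: gxy.
  rewrite inE imset_f //= /bip_join xW vuR; apply/exists_inP.
  by exists y.
rewrite lerD2r; apply: ler_wpM2r; first by rewrite ln_ge0 // ler1n.
apply: ler_wpM2r; first by rewrite invr_ge0 ltW.
by rewrite ler_nat; apply: leq_trans (leq_imset_card _ _) _; rewrite max_card.
Qed.

End ShortPaths.
End EdgeCounts.

(** * Arithmetic in fifth roots and the final count *)

(** Turns all bounds into monomials in the fifth roots of [n] and [ln n], within reach of [field]
    and [lra]. *)
Lemma powR_fifths (R : realType) (a : R) k :
  a `^ (k%:R / 5) = (a `^ (1 / 5)) ^+ k.
Proof. by rewrite -powR_mulrn ?powR_ge0 // -powRrM; congr powR; field. Qed.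

(** From [ln (1 / n) <= 1 / n - 1], which gives [ln n >= 1 - 1 / n]. *)
Lemma ln_nat_ge_half (R : realType) n : (2 <= n)%N -> 1 / 2 <= ln n%:R :> R.
Proof.
move=> n2; have n2' : 2 <= n%:R :> R by rewrite ler_nat.
have := @le_ln1Dx R (n%:R^-1 - 1); rewrite addrCA subrr addr0 lnV ?posrE; last lra.
have : 0 < n%:R^-1 :> R by rewrite invr_gt0; lra.
have : n%:R^-1 <= 2^-1 :> R by rewrite lef_pV2 ?posrE //; lra.
by move=> ? ? /(_ ltac:(lra)); lra.
Qed.

Theorem theorem3 (R : realType) :
  exists C : R, 0 < C /\
    forall (T : finType) (e : rel T),
      symmetric e -> irreflexive e -> (2 <= #|T|)%N ->
      forall H : {set {set T}}, spanner_output R e H ->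
        #|H|%:R <= C * (#|T|%:R `^ (7 / 5) * ln #|T|%:R `^ (3 / 5)).
Proof.
(* 149 = 1 + 8 + 14 + 1 + 125, for step 1, the heavy edges, the trees of step 6, the light edges and
   the paths of step 7. *)
exists 149; split=> // T e syme _ n2 H [] W H1 S1 c tr f S2 tr2 g RN.
move=> st1 gr1 _ trP fP gr2 _.
have := card_step1 _ st1; have := @card_light_edges R T g W.
have := @card_heavy_edges R T g W c; rewrite -(ler_nat R).
have := card_bigcup_tree_edges S2 tr2; rewrite -(ler_nat R).
have := @card_short_path_edges R T e W S1 tr f syme n2 trP fP.
have := card_S1 syme n2 _ gr1; have := card_S2 syme n2 trP fP _ gr2.
rewrite cards0 cardsT !natrM /bfs_threshold /heavy_threshold /path_threshold !powR_fifths.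
have lnh := ln_nat_ge_half R n2.
have n2' : 2 <= #|T|%:R :> R by rewrite ler_nat.
rewrite lnM ?posrE; try lra.
set n := #|T|%:R in lnh n2' *; set L := ln n in lnh *.
set x := n `^ _; set y := L `^ _.
have xn : n = x ^+ 5 by rewrite -(powR_fifths n 5) divff ?powRr1 //; lra.
have yL : L = y ^+ 5 by rewrite -(powR_fifths L 5) divff ?powRr1 //; lra.
have x0 : 0 < x by rewrite powR_gt0; lra.
have y0 : 0 < y by rewrite powR_gt0; lra.
have x1 : 1 <= x.
  rewrite leNgt; apply/negP => xlt.
  by have := exprn_ile1 5 (ltW x0) (ltW xlt); rewrite -xn; lra.
(* [ln n] is below 1 for [n = 2], so [y] is only bounded below by 1/2. *)
have y1 : 1 / 2 <= y.
  rewrite leNgt; apply/negP => ylt.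
  have : y ^+ 5 <= (1 / 2) ^+ 5 by rewrite lerXn2r ?nnegrE //; lra.
  by rewrite -yL; lra.
have Q0 : 0 < x ^+ 2 * y ^+ 3 by rewrite mulr_gt0 ?exprn_gt0.
have P0 : 0 < x ^+ 3 * y ^+ 2 by rewrite mulr_gt0 ?exprn_gt0.
have yh k : (1 / 2) ^+ k <= y ^+ k by rewrite lerXn2r ?nnegrE //; lra.
(* [Q1] and [P1] absorb the additive 1 of the greedy bounds: [6 + 8 = 14] for [S2] and [1 + 4 = 5]
   for [S1]. *)
have Q1 : 1 <= 8 * (x ^+ 2 * y ^+ 3).
  have := ler_pM ler01 _ (exprn_ege1 2 x1) (yh 3%N).
  by move=> /(_ ltac:(by rewrite exprn_ge0 //; lra)); lra.
have P1 : 1 <= 4 * (x ^+ 3 * y ^+ 2).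
  have := ler_pM ler01 _ (exprn_ege1 3 x1) (yh 2%N).
  by move=> /(_ ltac:(by rewrite exprn_ge0 //; lra)); lra.
(* [L + L] is the logarithm of the bound [n * n] on the number of right nodes. *)
have -> : n / (x ^+ 3 * y ^+ 2 / 3) * (L + L) = 6 * (x ^+ 2 * y ^+ 3).
  by rewrite yL xn; field; rewrite !gt_eqF.
have -> : n / (x ^+ 2 * y ^+ 3) * L = x ^+ 3 * y ^+ 2.
  by rewrite yL xn; field; rewrite !gt_eqF.
have -> : 5 * (x ^+ 3 * y ^+ 2) / (x ^+ 2 * y ^+ 3) = 5 * (x / y).
  by field; rewrite !gt_eqF.
have -> : n * (x ^+ 2 * y ^+ 3) = x ^+ 7 * y ^+ 3 by rewrite xn; ring.
have -> : n * (n / (x ^+ 3 / y ^+ 3)) = x ^+ 7 * y ^+ 3.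
  by rewrite xn; field; rewrite !gt_eqF.
move=> /(_ P0) S2n /(_ Q0) S1n /(_ Q0 P0) sl bfs he /(_ (ltW Q0)) li.
move=> /(_ ltac:(by rewrite divr_gt0 ?exprn_gt0)) h1.
have S2b : #|S2|%:R * n <= 14 * (x ^+ 7 * y ^+ 3).
  have -> : 14 * (x ^+ 7 * y ^+ 3) = 14 * (x ^+ 2 * y ^+ 3) * n by rewrite xn; ring.
  by apply: ler_wpM2r; lra.
have nb : n <= 8 * (x ^+ 7 * y ^+ 3).
  have -> : 8 * (x ^+ 7 * y ^+ 3) = 8 * (x ^+ 2 * y ^+ 3) * n by rewrite xn; ring.
  by rewrite ler_peMl //; lra.
have S1b : #|S1|%:R * (#|S1|%:R * (5 * (x / y))) <= 125 * (x ^+ 7 * y ^+ 3).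
  have -> : 125 * (x ^+ 7 * y ^+ 3) =
      5 * (x ^+ 3 * y ^+ 2) * (5 * (x ^+ 3 * y ^+ 2) * (5 * (x / y))).
    by field; rewrite !gt_eqF.
  have xy : 0 <= 5 * (x / y) by rewrite mulr_ge0 // divr_ge0 // ltW.
  have S15 : #|S1|%:R <= 5 * (x ^+ 3 * y ^+ 2) by lra.
  by apply: ler_pM => //; [apply: mulr_ge0|apply: ler_wpM2r].
set Ht := \bigcup_(v in S2) _ in bfs *.
set Hs := short_path_edges _ _ _ _ _ in sl *.
set Hh := heavy_edges _ _ _ _ in he *.
set Hl := light_edges _ _ _ in sl li *.
(* Light edges are regrouped with the paths of step 7, as these were bounded together. *)
have : (#|H1 :|: Hl :|: Hh :|: Ht :|: Hs| <= #|H1| + #|Hh| + #|Ht| + #|Hl :|: Hs|)%N.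
  apply: (@leq_trans #|H1 :|: Hh :|: Ht :|: (Hl :|: Hs)|); last first.
    apply: leq_trans (leq_card_setU _ _) _; rewrite leq_add2r.
    apply: leq_trans (leq_card_setU _ _) _; rewrite leq_add2r.
    exact: leq_card_setU.
  apply/subset_leq_card/subsetP => z.
  by rewrite !in_setU; do 5!case: (z \in _).
by rewrite -(ler_nat R) !natrD; lra.
Qed.
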